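(* For every integer $n\ge 8$ there exists a matrix $T\in M_n(\mathbb{C})$ which is unitarily equivalent to its transpose $T^t$ but which is not unitarily equivalent to any complex symmetric matrix.
   Context: Two matrices $A,B\in M_n(\mathbb{C})$ are unitarily equivalent if $A=UBU^*$ for some unitary $U\in M_n(\mathbb{C})$. A complex symmetric matrix is a complex square matrix $S$ with $S=S^t$, where $S^t$ is the (non-conjugated) transpose. *)

(* Defs.v *)
From HB Require Import structures.
From mathcomp Require Import all_boot all_order all_algebra.
From mathcomp Require Import complex reals.
Set Implicit Arguments.
Unset Strict Implicit.
Unset Printing Implicit Defensive.
Import Order.TTheory GRing.Theory Num.Theory.
Local Open Scope ring_scope.
Local Open Scope sesquilinear_scope.

Definition unitarily_equivalent (C : numClosedFieldType) (n : nat)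
    (A B : 'M[C]_n) : Prop :=
  exists2 U : 'M[C]_n, U \is unitarymx & A = U *m B *m U ^t*.

(* Plain transpose, without complex conjugation. *)
Definition complex_symmetric (C : numClosedFieldType) (n : nat)
    (S : 'M[C]_n) : Prop := S = S^T.

(* Main.v *)
Require Import Defs.
From HB Require Import structures.
From mathcomp Require Import all_boot all_order all_algebra.
From mathcomp Require Import complex reals.
Set Implicit Arguments.
Unset Strict Implicit.
Unset Printing Implicit Defensive.
Import Order.TTheory GRing.Theory Num.Theory.
Local Open Scope ring_scope.

(** A skew-Hamiltonian matrix [T] (that is, [T = H + i K] with [H] and [K]
    quaternionic Hermitian) satisfies [T = J T^T J^*] with [J] unitary and
    skew-symmetric. If [T] were unitarily equivalent to a symmetric matrix
    through [U], then [W := U U^T] would be a symmetric unitary intertwiner of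
    [T^T] and [T], and also of [conj T] and [T^*]. The Hermitian part of the [T]
    chosen here is diagonal with four distinct double nonzero eigenvalues (at
    the indices [k] and [k + 4]), padded by zeros, which makes [W] block
    diagonal; the quaternionic entries of the other part then force each of the
    four 2x2 blocks of [W] to be a multiple of [[0, 1], [-1, 0]], hence zero by
    symmetry. *)

Section UnitaryEquivalence.
Local Open Scope sesquilinear_scope.
Variable C : numClosedFieldType.

Lemma mul_trmxC_unitary n (U : 'M[C]_n) : U \is unitarymx -> U ^t* *m U = 1%:M.
Proof. by move=> /unitarymxP/mulmx1C. Qed.

(** Both sides reduce to [U *m S *m U^T]: on the right [U ^t* *m U] cancels, on the left its
    transpose does. *)
Lemma symmetric_intertwine n (U S : 'M[C]_n) : U \is unitarymx -> S = S^T ->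
  let T := U *m S *m U ^t* in (U *m U^T) *m T^T = T *m (U *m U^T).
Proof.
move=> Uu sS /=; rewrite !trmx_mul -sS.
rewrite -[RHS]mulmxA [U ^t* *m _]mulmxA mul_trmxC_unitary // mul1mx.
rewrite -!mulmxA; congr (_ *m _); rewrite !mulmxA -trmx_mul.
by rewrite mul_trmxC_unitary // trmx1 mul1mx.
Qed.

Lemma uecsm_intertwine n (T S : 'M[C]_n) :
    complex_symmetric S -> unitarily_equivalent T S ->
  exists W : 'M[C]_n, [/\ W \in unitmx, W^T = W, W *m T^T = T *m W
    & W *m (T ^t*)^T = T ^t* *m W].
Proof.
move=> sS [U Uu ->]; exists (U *m U^T); split.
- by rewrite unitmx_mul unitmx_tr unitarymx_unit.
- by rewrite trmx_mul trmxK.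
- exact: symmetric_intertwine.
(* The adjoint comes from [S ^t*], again symmetric, through the same [U], so the same [W] serves. *)
have -> : (U *m S *m U ^t*) ^t* = U *m S ^t* *m U ^t*.
  by rewrite !trmx_mul !map_mxM /= trmxCK mulmxA.
by apply: symmetric_intertwine => //; rewrite -sS map_trmx -sS.
Qed.

(** Conjugation by [J = [[0, 1], [-1, 0]]] swaps the diagonal blocks, and swaps and negates the
    other two; for skew [B] and [D] this is transposition. *)
Lemma skew_hamiltonian_uet m (A B D : 'M[C]_m) : B^T = - B -> D^T = - D ->
  let T := block_mx A B D A^T in unitarily_equivalent T T^T.
Proof.
move=> sB sD /=.
have JC : (block_mx 0 1%:M (- 1%:M) 0) ^t* = block_mx 0 (- 1%:M) 1%:M 0 :> 'M[C]_(m + m).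
  by rewrite tr_block_mx map_block_mx linearN /= !trmx0 trmx1 !map_mx0 map_mxN map_mx1.
exists (block_mx 0 1%:M (- 1%:M) 0).
  apply/unitarymxP; rewrite JC mulmx_block !mulmx0 !mul0mx !addr0 !add0r.
  by rewrite mulNmx mulmxN !mulmx1 opprK -scalar_mx_block.
rewrite JC tr_block_mx sB sD trmxK !mulmx_block !mulmx0 !mul0mx !addr0 !add0r.
by rewrite !mulNmx !mulmxN !mulmx1 !mul1mx !opprK.
Qed.

Lemma uet_dsum0 m p (T : 'M[C]_m) : unitarily_equivalent T T^T ->
  let T' := block_mx T 0 0 (0 : 'M[C]_p) in unitarily_equivalent T' T'^T.
Proof.
case=> U /unitarymxP Uu eT /=; exists (block_mx U 0 0 1%:M).
  apply/unitarymxP; rewrite tr_block_mx map_block_mx mulmx_block.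
  rewrite trmx1 map_mx1 !trmx0 !map_mx0 Uu.
  by rewrite !mulmx0 !mul0mx mulmx1 !addr0 add0r -scalar_mx_block.
rewrite !tr_block_mx map_block_mx !mulmx_block trmx1 map_mx1 !trmx0 !map_mx0.
by rewrite !mulmx0 !mul0mx !addr0 !mul0mx !addr0 -eT.
Qed.

(** The off-diagonal part is skew-Hermitian, so only the diagonal survives in [blockA + blockA ^t*].
    Its symmetric entries ['i] will equate entries of [W]; its antisymmetric pair at (1, 2) will
    make them vanish. *)
Definition blockA : 'M[C]_4 := \matrix_(i, j)
  if i == j then i.+1%:R else if (i == 0) || (j == 0) then 'i else
  if (i == 1) && (j == 2) then -1 else if (i == 2) && (j == 1) then 1 else 0.

(** Skew-symmetry gives equivalence to the transpose; being Hermitian makes [blockB] and [- blockB]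
    cancel in the Hermitian part of [uet8]. *)
Definition blockB : 'M[C]_4 := \matrix_(i, j)
  if (i == 1) && (j == 3) then 'i else if (i == 3) && (j == 1) then - 'i else 0.

Definition uet8 : 'M[C]_(4 + 4) := block_mx blockA blockB (- blockB) blockA^T.

Definition uet8_pad p : 'M[C]_(4 + 4 + p) := block_mx uet8 0 0 0.

Lemma blockB_skew : blockB^T = - blockB.
Proof.
apply/matrixP=> i j; rewrite !mxE.
by case: i => [[|[|[|[|i]]]] Hi] //; case: j => [[|[|[|[|j]]]] Hj] //=;
  rewrite ?(oppr0, opprK).
Qed.

Lemma uet8_pad_uet p : unitarily_equivalent (uet8_pad p) (uet8_pad p)^T.
Proof.
apply: uet_dsum0; apply: skew_hamiltonian_uet; first exact: blockB_skew.
by rewrite linearN /= blockB_skew.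
Qed.

Lemma blockA_herm : blockA + blockA ^t* = diag_mx (\row_j (j.+1%:R *+ 2)).
Proof.
apply/matrixP=> i j; rewrite !mxE.
by case: i => [[|[|[|[|i]]]] Hi] //; case: j => [[|[|[|[|j]]]] Hj] //=;
  rewrite ?(conjCi, conjC0, conjC1, rmorphN, rmorph1, rmorph_nat, addrN, addNr, addr0).
Qed.

Lemma blockB_herm : blockB ^t* = blockB.
Proof.
apply/matrixP=> i j; rewrite !mxE.
by case: i => [[|[|[|[|i]]]] Hi] //; case: j => [[|[|[|[|j]]]] Hj] //=;
  rewrite ?(conjC0, rmorphN) /= ?(conjCi, opprK).
Qed.

Lemma uet8_pad_herm p : exists2 h : 'rV[C]_(4 + 4 + p),
    uet8_pad p + (uet8_pad p) ^t* = diag_mx h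
  & h = row_mx (let r := \row_(j < 4) (j.+1%:R *+ 2) in row_mx r r) 0.
Proof.
set r : 'rV[C]_4 := \row_j _; exists (row_mx (row_mx r r) 0) => //.
rewrite /uet8_pad /uet8 !tr_block_mx !map_block_mx !add_block_mx.
rewrite !diag_mx_row !raddf0 !addr0.
have -> : (- blockB) ^t* = - blockB.
  by rewrite linearN /= map_mxN blockB_herm.
rewrite blockB_herm subrr addNr blockA_herm.
have -> // : blockA^T + (blockA^T)^t* = diag_mx r.
by rewrite -map_trmx -linearD /= blockA_herm tr_diag_mx.
Qed.


Lemma diag_mx_intertwine n (W : 'M[C]_n) (h : 'rV_n) i j :
  W *m diag_mx h = diag_mx h *m W -> h 0 i != h 0 j -> W i j = 0.
Proof.
rewrite mul_mx_diag mul_diag_mx => /matrixP/(_ i j); rewrite !mxE mulrC.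
move=> /eqP; rewrite -subr_eq0 -mulrBl mulf_eq0 subr_eq0 => /orP[/eqP->|/eqP//].
by rewrite eqxx.
Qed.

Lemma natr_double_inj (i j : nat) : (i%:R *+ 2 == j%:R *+ 2 :> C) = (i == j).
Proof. by rewrite eqrMn2r /= eqr_nat. Qed.

Lemma uet8_pad_not_uecsm p (S : 'M[C]_(4 + 4 + p)) :
  complex_symmetric S -> ~ unitarily_equivalent (uet8_pad p) S.
Proof.
move=> sS uS; have [W [Wu sW WT WTC]] := uecsm_intertwine sS uS.
have [h hE defh] := uet8_pad_herm p.
(* Add the two intertwining relations; a diagonal matrix is its own transpose. *)
have Wh : W *m diag_mx h = diag_mx h *m W.
  by rewrite -hE mulmxDl -WT -WTC -mulmxDr -linearD /= hE tr_diag_mx.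
have W0 i j : h 0 i != h 0 j -> W i j = 0 by exact: diag_mx_intertwine.
have hl k : h 0 (lshift p (lshift 4 k)) = k.+1%:R *+ 2.
  by rewrite defh !row_mxEl mxE.
have hr k : h 0 (lshift p (rshift 4 k)) = k.+1%:R *+ 2.
  by rewrite defh row_mxEl row_mxEr mxE.
have hp k : h 0 (rshift (4 + 4) k) = 0 by rewrite defh row_mxEr mxE.
(* The block of [W] on the indices [k] and [k + 4] is [[[a k, b k], [b k, c k]]], by symmetry of
   [W]. *)
pose V := ulsubmx W; pose a k := W (lshift p (lshift 4 k)) (lshift p (lshift 4 k)).
pose b k := W (lshift p (lshift 4 k)) (lshift p (rshift 4 k)).
pose c k := W (lshift p (rshift 4 k)) (lshift p (rshift 4 k)).
have Pa : ulsubmx V = diag_mx (\row_k a k).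
  apply/matrixP=> i j; rewrite !mxE; case: eqVneq => [->//|ij].
  by rewrite W0 // !hl natr_double_inj.
have Qb : ursubmx V = diag_mx (\row_k b k).
  apply/matrixP=> i j; rewrite !mxE; case: eqVneq => [->//|ij].
  by rewrite W0 // hl hr natr_double_inj.
have Rb : dlsubmx V = diag_mx (\row_k b k).
  by rewrite -tr_diag_mx -Qb trmx_ursub /V trmx_ulsub sW.
have Sc : drsubmx V = diag_mx (\row_k c k).
  apply/matrixP=> i j; rewrite !mxE; case: eqVneq => [->//|ij].
  by rewrite W0 // !hr natr_double_inj.
have VT : V *m uet8^T = uet8 *m V.
  move: WT; rewrite -[W]submxK /uet8_pad tr_block_mx !mulmx_block.
  by rewrite !trmx0 !(mulmx0, mul0mx, addr0) => /eq_block_mx[].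
have [eqa eqb] : diag_mx (\row_k a k) *m blockA^T - diag_mx (\row_k b k) *m blockB
    = blockA *m diag_mx (\row_k a k) + blockB *m diag_mx (\row_k b k) /\
  diag_mx (\row_k a k) *m blockB + diag_mx (\row_k b k) *m blockA =
    blockA *m diag_mx (\row_k b k) + blockB *m diag_mx (\row_k c k).
  move: VT; rewrite -[V]submxK Pa Qb Rb Sc /uet8 tr_block_mx !mulmx_block.
  by rewrite linearN /= blockB_skew opprK trmxK mulmxN => /eq_block_mx[].
have ea i j : a i * blockA j i - b i * blockB i j
            = blockA i j * a j + blockB i j * b j.
  by move/matrixP/(_ i j): eqa; rewrite !mul_mx_diag !mul_diag_mx !mxE.
have eb i j : a i * blockB i j + b i * blockA i j
            = blockA i j * b j + blockB i j * c j.
  by move/matrixP/(_ i j): eqb; rewrite !mul_mx_diag !mul_diag_mx !mxE.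
have i0 := neq0Ci C.
(* Row 0 of [blockB] is zero, so only the entries ['i] of [blockA] remain, and they cancel. *)
have a01 : a 0 = a 1.
  by have := ea 0 1; rewrite !mxE /= !mulr0 mul0r subr0 addr0 mulrC => /(mulfI i0).
have a02 : a 0 = a 2.
  by have := ea 0 2; rewrite !mxE /= !mulr0 mul0r subr0 addr0 mulrC => /(mulfI i0).
have b01 : b 0 = b 1.
  by have := eb 0 1; rewrite !mxE /= !mulr0 mul0r add0r addr0 mulrC => /(mulfI i0).
have b03 : b 0 = b 3.
  by have := eb 0 3; rewrite !mxE /= !mulr0 mul0r add0r addr0 mulrC => /(mulfI i0).
have opp_eq0 (x : C) : x = - x -> x = 0.
  by move=> /eqP; rewrite -addr_eq0 -mulr2n mulrn_eq0 => /eqP.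
(* The antisymmetric pair of [blockA] gives [a 1 = - a 2]. *)
have a0 : a 0 = 0.
  apply: opp_eq0; have := ea 1 2; rewrite !mxE /= -a01 -a02.
  by rewrite !mulr0 mul0r subr0 addr0 mulr1 mulN1r.
(* At (1, 3) [blockA] vanishes, leaving [- b 1 * 'i = 'i * b 3]. *)
have b0 : b 0 = 0.
  apply: opp_eq0; apply: (mulfI i0); have := ea 1 3; rewrite !mxE /= -b01 -b03.
  by rewrite !mulr0 mul0r sub0r add0r mulrN mulrC => ->.
(* One zero row already contradicts invertibility. In row 0 only [a 0] and [b 0] could be nonzero,
   since [h] takes the value 2 at the indices 0 and 4 alone. *)
have rowW0 j : W (lshift p (lshift 4 0)) j = 0.
  rewrite -(splitK j); case: (split j) => [k|k] /=.
    rewrite -(splitK k); case: (split k) => [l|l] /=.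
      have [->|l0] := eqVneq l 0; first exact: a0.
      by rewrite W0 // !hl natr_double_inj eq_sym.
    have [->|l0] := eqVneq l 0; first exact: b0.
    by rewrite W0 // hl hr natr_double_inj eq_sym.
  by rewrite W0 // hl hp mulrn_eq0 pnatr_eq0.
have /matrixP/(_ (lshift p (lshift 4 0)) (lshift p (lshift 4 0))) := mulmxV Wu.
rewrite !mxE eqxx big1 => [/eqP|k _]; last by rewrite rowW0 mul0r.
by rewrite eq_sym oner_eq0.
Qed.

End UnitaryEquivalence.

Theorem mainTheorem3 (R : realType) (n : nat) (hn : (8 <= n)%N) :
  exists T : 'M[R[i]]_n,
    unitarily_equivalent T T^T /\
    ~ (exists S : 'M[R[i]]_n,
         complex_symmetric S /\ unitarily_equivalent T S).
Proof.
rewrite -(subnKC hn); exists (uet8_pad R[i] (n - 8)); split.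
  exact: uet8_pad_uet.
by case=> S [sS]; apply: uet8_pad_not_uecsm.
Qed.
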